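(* Every finitely generated nilpotent group is algebraically recurrent.
   Context: For a countable group $G$ and a probability measure $\mu$ on $G$, a $\mu$-random walk is $X_n=\zeta_1\cdots\zeta_n$ with $\zeta_i$ i.i.d. of law $\mu$; $\mathcal{S}_n$ denotes the semigroup generated by $\{X_n,X_{n+1},\ldots\}$. $(G,\mu)$ is algebraically recurrent (AR) if for every $n$, $\mathcal{S}_n=G$ almost surely; $G$ is AR if $(G,\mu)$ is AR for every symmetric probability measure $\mu$ (i.e. $\mu(g)=\mu(g^{-1})$) whose support generates $G$ as a group. *)

(* Defs.v *)
From HB Require Import structures.
From mathcomp Require Import all_boot all_order all_algebra.
From mathcomp Require Import all_classical all_reals all_analysis.
Set Implicit Arguments. Unset Strict Implicit. Unset Printing Implicit Defensive.
Import Order.TTheory GRing.Theory Num.Theory.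
Local Open Scope classical_set_scope.

Section GroupDefs.
Variable G : groupType.
Local Open Scope group_scope.

Inductive subgroup_gen (S : set G) : G -> Prop :=
| sgen_in x : S x -> subgroup_gen S x
| sgen_one : subgroup_gen S 1
| sgen_mul x y : subgroup_gen S x -> subgroup_gen S y -> subgroup_gen S (x * y)
| sgen_inv x : subgroup_gen S x -> subgroup_gen S (x^-1).

Inductive semigroup_gen (S : set G) : G -> Prop :=
| semi_in x : S x -> semigroup_gen S x
| semi_mul x y : semigroup_gen S x -> semigroup_gen S y -> semigroup_gen S (x * y).

Definition finitely_generated : Prop :=
  exists s : seq G, forall x, subgroup_gen [set y | y \in s] x.

Fixpoint lower_central (i : nat) : set G :=
  match i with
  | 0 => setT
  | i.+1 => subgroup_gen [set z | exists x y, lower_central i x /\ z = [~ x, y]]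
  end.

Definition nilpotent : Prop :=
  exists c : nat, forall x, lower_central c x -> x = 1.

(* X_n = zeta_1 ... zeta_n ; here zeta_{i+1} is [zeta i], so
   X_n = zeta 0 * ... * zeta (n-1) and X_0 = 1. *)
Definition rw_pos {T : Type} (zeta : nat -> T -> G) (n : nat) (w : T) : G :=
  \prod_(0 <= i < n) zeta i w.

Definition rw_semigroup {T : Type} (zeta : nat -> T -> G) (n : nat) (w : T)
  : set G :=
  semigroup_gen [set g | exists m, (n <= m)%N /\ g = rw_pos zeta m w].

Definition symmetric_measure {R : realType} (mu : G -> R) : Prop :=
  forall g, mu g^-1 = mu g.

Definition is_prob_on_group {R : realType} (mu : G -> R) : Prop :=
  (forall g, (0 <= mu g)%R) /\ esum [set: G] (fun g => (mu g)%:E) = 1%E.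

Definition iid_with_law {R : realType} (d : measure_display)
  (T : measurableType d) (P : probability T R) (mu : G -> R)
  (zeta : nat -> T -> G) : Prop :=
  (forall i g, measurable [set w | zeta i w = g]) /\
  (forall (n : nat) (g : nat -> G),
     P [set w | forall i, (i < n)%N -> zeta i w = g i]
       = (\prod_(0 <= i < n) mu (g i))%:E).

Definition alg_recurrent_measure {R : realType} (mu : G -> R) : Prop :=
  forall (d : measure_display) (T : measurableType d) (P : probability T R)
         (zeta : nat -> T -> G),
    iid_with_law P mu zeta ->
    forall n : nat,
      P.-negligible [set w | ~ (forall x : G, rw_semigroup zeta n w x)].

Definition alg_recurrent : Prop :=
  forall (R : realType) (mu : G -> R),
    is_prob_on_group mu -> symmetric_measure mu ->
    (forall x, subgroup_gen [set g | (0 < mu g)%R] x) ->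
    alg_recurrent_measure mu.

End GroupDefs.

(* Main.v *)
Require Import Defs.
From HB Require Import structures.
From mathcomp Require Import all_boot all_order all_algebra.
From mathcomp Require Import all_classical all_reals all_analysis.
From mathcomp Require Import zify ring lra.
Set Implicit Arguments. Unset Strict Implicit. Unset Printing Implicit Defensive.
Import Order.TTheory GRing.Theory Num.Theory.
Import numFieldNormedType.Exports.
Local Open Scope classical_set_scope.

(** Let [S] be the semigroup generated by the tail of the walk.

    Onto the abelianization [A].  For [K] a subset of [A], the probability that
    [x + X_m] visits [K] infinitely often does not depend on [x]: deleting the
    [N]-th increment shows that its correlation with [zeta_N = g] is the same
    for all [N], and it must vanish as [N] tends to infinity.  Hence this
    probability is 0 or 1, and it is the same for [K], [- K] and all their
    translates.  So there is an ultrafilter [p] on [A] such that almost surely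
    the walk visits every set [+- K + c], [K] in [p], infinitely often.  Any
    [d + 1] elements [z_i] of [A] satisfy an integer relation
    [sum a_i z_i = 0], and the signs [s_i] of the [a_i] are constant on a
    [p]-generic tuple; choosing such a tuple with [s_i z_i + c] in [S] gives
    [sum |a_i| (s_i z_i + c) = (sum |a_i|) c] in [S].  As [c] is arbitrary, the
    image of [S] is a group, and it contains every increment that occurs.

    From the abelianization to [G].  Let [k = [x, y]] be central and let [S] map
    onto the quotient by the powers of [k].  With [x, x', y, y'] in [S] such
    that [x x' = k^p] and [y y' = k^q], the words [x'^a y'^b x^a y^b] and
    [y'^b x'^a y^b x^a] give [k^(a p + b q +- a b)] in [S], where the quadratic
    term dominates; hence [S] contains all powers of [k].  Applying this to the
    finitely many commutators that generate each term of the lower central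
    series modulo the next one, [S] is the whole group. *)

(** * Quotients by normal subgroups *)

Section Quotient.
Variable G : groupType.
Local Open Scope group_scope.

Record normal_subgroup := NormalSubgroup {
  nsub :> G -> Prop;
  nsub1 : nsub 1;
  nsubM : forall x y, nsub x -> nsub y -> nsub (x * y);
  nsubV : forall x, nsub x -> nsub x^-1;
  nsubJ : forall x g, nsub x -> nsub (x ^ g) }.

Variable N : normal_subgroup.

Lemma nsub_quot_sym x y : N (x^-1 * y) -> N (y^-1 * x).
Proof. by move=> /nsubV; rewrite invgM invgK. Qed.

Lemma nsub_quot_trans y x z : N (x^-1 * y) -> N (y^-1 * z) -> N (x^-1 * z).
Proof. by move=> xy yz; have := nsubM xy yz; rewrite mulgA mulgK. Qed.

(** A representative chosen from the coset of [x] as a set, so that equal cosets get equal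
    representatives and the quotient is a subtype of [G]. *)
Definition qcanon (x : G) : G := xget 1 [set y | N (x^-1 * y)].

Lemma qcanonP x : N (x^-1 * qcanon x).
Proof.
by rewrite /qcanon; apply: (@xgetPex _ 1 [set y | N (x^-1 * y)]);
   exists x; rewrite /= mulVg; exact: nsub1.
Qed.

Lemma qcanon_eq x y : N (x^-1 * y) -> qcanon x = qcanon y.
Proof.
move=> xy; rewrite /qcanon; congr (xget _ _); apply/seteqP; split => z /= h.
  exact: nsub_quot_trans (nsub_quot_sym xy) h.
exact: nsub_quot_trans xy h.
Qed.

Record quot := Quot { qval : G; _ : qcanon qval == qval }.
HB.instance Definition _ := [isSub for qval].
HB.instance Definition _ := [Choice of quot by <:].

Lemma qcanonK x : qcanon (qcanon x) == qcanon x.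
Proof. by apply/eqP/esym/qcanon_eq/qcanonP. Qed.

Definition qproj (x : G) : quot := Quot (qcanonK x).

Lemma qproj_eq x y : N (x^-1 * y) -> qproj x = qproj y.
Proof. by move=> xy; apply/val_inj => /=; exact: qcanon_eq. Qed.

Lemma qproj_inj x y : qproj x = qproj y -> N (x^-1 * y).
Proof.
move=> /(congr1 qval) /= xy; apply: nsub_quot_trans (qcanonP x) _.
by rewrite xy; exact/nsub_quot_sym/qcanonP.
Qed.

Lemma qprojK a : qproj (qval a) = a.
Proof. by apply/val_inj => /=; apply/eqP; case: a. Qed.

Definition qmul (a b : quot) : quot := qproj (qval a * qval b).
Definition qinv (a : quot) : quot := qproj (qval a)^-1.

Lemma qprojM x y : qproj (x * y) = qmul (qproj x) (qproj y).
Proof.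
apply: qproj_eq; rewrite /= invgM.
have -> : y^-1 * x^-1 * (qcanon x * qcanon y) =
   (x^-1 * qcanon x) ^ y * (y^-1 * qcanon y).
  by rewrite conjgE !mulgA mulgK.
by apply: nsubM; [apply/nsubJ|]; exact: qcanonP.
Qed.

Lemma qprojV x : qproj x^-1 = qinv (qproj x).
Proof.
apply: qproj_eq; rewrite /= invgK.
have := nsubJ x^-1 (nsubV (qcanonP x)).
by rewrite conjgE invgM !invgK !mulgA mulgK.
Qed.

Lemma qmulA : associative qmul.
Proof.
by move=> a b c; rewrite -(qprojK a) -(qprojK b) -(qprojK c) -!qprojM mulgA.
Qed.

Lemma qmul1 : left_id (qproj 1) qmul.
Proof. by move=> a; rewrite -(qprojK a) -qprojM mul1g. Qed.

Lemma qmulr1 : right_id (qproj 1) qmul.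
Proof. by move=> a; rewrite -(qprojK a) -qprojM mulg1. Qed.

Lemma qmulV : left_inverse (qproj 1) qinv qmul.
Proof. by move=> a; rewrite -(qprojK a) -qprojV -qprojM mulVg. Qed.

Lemma qmulrV : right_inverse (qproj 1) qinv qmul.
Proof. by move=> a; rewrite -(qprojK a) -qprojV -qprojM mulgV. Qed.

HB.instance Definition _ := isGroup.Build quot qmulA qmul1 qmulr1 qmulV qmulrV.

Lemma qproj_mul x y : qproj (x * y) = qproj x * qproj y.
Proof. exact: qprojM. Qed.

Lemma qproj_inv x : qproj x^-1 = (qproj x)^-1.
Proof. exact: qprojV. Qed.

Lemma qproj_comm x y : qproj [~ x, y] = [~ qproj x, qproj y].
Proof. by rewrite commgEl conjgE !qproj_mul !qproj_inv. Qed.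

Lemma qproj1 x : N x -> qproj x = 1.
Proof. by move=> Nx; apply/esym/qproj_eq; rewrite invg1 mul1g. Qed.

(** An alias of [quot] indexed by the proof that commutators lie in [N]: it carries the additive
    structure, while [quot] itself keeps the multiplicative one. *)
Definition abquot of (forall x y, N [~ x, y]) := quot.

Section AbQuot.
Variable NC : forall x y, N [~ x, y].
HB.instance Definition _ := Choice.on (abquot NC).

Lemma qmulC : commutative qmul.
Proof.
move=> a b; rewrite -(qprojK a) -(qprojK b) -!qprojM; apply: qproj_eq.
by rewrite invgM !mulgA; have := NC (qval b) (qval a); rewrite commgEl conjgE !mulgA.
Qed.

HB.instance Definition _ := GRing.isZmodule.Build (abquot NC) qmulA qmulC qmul1 qmulV.

Definition abproj (x : G) : abquot NC := qproj x.

Lemma abprojM x y : abproj (x * y) = (abproj x + abproj y)%R.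
Proof. exact: qprojM. Qed.

Lemma abproj_surj (a : abquot NC) : exists x, abproj x = a.
Proof. by exists (qval a); exact: qprojK. Qed.

Lemma abproj_inj x y : abproj x = abproj y -> N (x^-1 * y).
Proof. exact: qproj_inj. Qed.

End AbQuot.
End Quotient.

(** * Additively closed sets of integers *)

Lemma int_mulrn (x : int) (n : nat) : (x *+ n = x * n%:Z)%R.
Proof. by rewrite -mulr_natr natz. Qed.

Section IntAddClosed.
Local Open Scope ring_scope.
Variable T : int -> Prop.
Hypothesis TD : forall a b, T a -> T b -> T (a + b).

Lemma addclosed_mulrn a (n : nat) : T a -> T (a *+ n.+1).
Proof.
by move=> Ta; elim: n => [|n IH]; rewrite ?mulr1n// mulrS; exact: TD.
Qed.

(** For [x = i + 1] and [y = - (j + 1)] in [T] one has [- x = j x + (i + 1) y] and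
    [- y = (j + 1) x + i y]. A nonzero [m] is paired with whichever of [u], [v] has the opposite
    sign. *)
Lemma addclosed_opp u v : T u -> T v -> 0 < u -> v < 0 ->
  forall m, T m -> T (- m).
Proof.
have key (x y : int) : T x -> T y -> 0 < x -> y < 0 -> T (- x) /\ T (- y).
  move=> Tx Ty x0 y0.
  have [i xE] : exists i : nat, x = i.+1 by exists `|x|%N.-1; lia.
  have [j yE] : exists j : nat, y = - (j.+1%:Z) by exists `|y|%N.-1; lia.
  have T0 : T 0.
    suff <- : x *+ j.+1 + y *+ i.+1 = 0 by apply: TD; exact: addclosed_mulrn.
    by rewrite xE yE !int_mulrn; ring.
  split.
    suff <- : x *+ j + y *+ i.+1 = - x.
      by case: j {yE} => [|j]; rewrite ?mulr0n ?add0r; [|apply: TD];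
         exact: addclosed_mulrn.
    by rewrite xE yE !int_mulrn; ring.
  suff <- : x *+ j.+1 + y *+ i = - y.
    by case: i {xE} => [|i]; rewrite ?mulr0n ?addr0; [|apply: TD];
       exact: addclosed_mulrn.
  by rewrite xE yE !int_mulrn; ring.
move=> Tu Tv u0 v0 m Tm; have [m0|m0|->] := ltgtP m 0.
- by have [] := key _ _ Tu Tm u0 m0.
- by have [] := key _ _ Tm Tv m0 v0.
- by have [Tu' _] := key _ _ Tu Tv u0 v0; rewrite oppr0 -(subrr u); exact: TD.
Qed.

(* The quadratic term dominates, so [T] meets both half-lines, hence is a
   group; then [1 = (p + q + 1) - p - q] lies in it. *)
Lemma addclosed_quadratic (p q : int) : T p -> T q ->
  (forall a b : nat, T (p *+ a.+1 + q *+ b.+1 + (a.+1 * b.+1)%N%:Z)) ->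
  (forall a b : nat, T (p *+ a.+1 + q *+ b.+1 - (a.+1 * b.+1)%N%:Z)) ->
  forall m, T m.
Proof.
move=> Tp Tq Tpos Tneg.
(* At [a = b = t] the two values factor as [(t + 1) (p + q +- (t + 1))], whose signs this choice of
   [t] forces. *)
pose t := absz (p + q).
have TN : forall m, T m -> T (- m).
  apply: addclosed_opp (Tpos t t) (Tneg t t) _ _.
    have -> : p *+ t.+1 + q *+ t.+1 + (t.+1 * t.+1)%N%:Z = t.+1%:Z * (p + q + t.+1%:Z).
      by rewrite !int_mulrn PoszM; ring.
    by rewrite mulr_gt0 // /t; lia.
  have -> : p *+ t.+1 + q *+ t.+1 - (t.+1 * t.+1)%N%:Z = t.+1%:Z * (p + q - t.+1%:Z).
    by rewrite !int_mulrn PoszM; ring.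
  by rewrite pmulr_rlt0 // /t; lia.
have T1 : T 1.
  have := TD (TD (Tpos 0 0) (TN _ Tp)) (TN _ Tq).
  by rewrite !mulr1n; congr T; ring.
have Tn (n : nat) : T n.+1.
  by have := addclosed_mulrn n T1; congr T; rewrite int_mulrn mul1r.
move=> [[|n]|n]; last by rewrite NegzE; apply: TN.
- by have := TD T1 (TN _ T1); rewrite subrr.
- exact: Tn.
Qed.

End IntAddClosed.

(** * Integer powers and central commutators *)

Section ZPower.
Variable G : groupType.
Local Open Scope group_scope.

Definition zexpg (x : G) (m : int) : G :=
  match m with Posz n => x ^+ n | Negz n => x ^- n.+1 end.

Lemma zexpgB x (i j : nat) : zexpg x (i%:Z - j%:Z)%R = x ^+ i * x ^- j.
Proof.
have [ji|ij] := leqP j i.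
  rewrite -(subnK ji) PoszD addrK /= expgnDr -mulgA.
  by rewrite mulgV mulg1.
rewrite -(subnK (ltnW ij)) PoszD opprD addrCA subrr addr0 -subSS subSn //.
rewrite -NegzE /= expgnDr invgM.
have -> : (j - i.+1).+1 = (j - i)%N by lia.
by rewrite mulgA mulgV mul1g.
Qed.

Lemma zexpgD x m n : zexpg x (m + n)%R = zexpg x m * zexpg x n.
Proof.
have E (k : int) : exists i j : nat, k = (i%:Z - j%:Z)%R.
  case: k => k; first by exists k, 0; rewrite subr0.
  by exists 0, k.+1; rewrite NegzE sub0r.
have [i [j ->]] := E m; have [k [l ->]] := E n.
rewrite addrACA -opprD -!PoszD !zexpgB expgnDr (addnC j) expgnDr invgM -!mulgA.
congr (_ * _); rewrite !mulgA; congr (_ * _).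
exact/commuteV/commuteX2/commute_refl.
Qed.

Lemma zexpg_central x m : (forall y, commute x y) -> forall y, commute (zexpg x m) y.
Proof.
move=> xC y; apply: commute_sym; case: m => n /=; last apply: commuteV.
  by apply: commuteX; apply: commute_sym.
by apply: commuteX; apply: commute_sym.
Qed.

Lemma zexpg_natr x m (n : nat) : (zexpg x m) ^+ n = zexpg x (m *+ n)%R.
Proof. by elim: n => [|n IH] //; rewrite expgS IH mulrS zexpgD. Qed.

End ZPower.

Section CentralCommutator.
Variable G : groupType.
Local Open Scope group_scope.
Variables (x y : G).
Hypothesis kC : forall g, commute [~ x, y] g.

(** Since [[~ x, y]] is central, each conjugation of [x] by [y] contributes one more factor
    [[~ x, y]]; the [a]-th power then multiplies the exponent by [a]. *)
Lemma commXX_central a b : [~ x ^+ a, y ^+ b] = [~ x, y] ^+ (a * b).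
Proof.
have xJ n : x ^ (y ^+ n) = x * [~ x, y] ^+ n.
  elim: n => [|n IH]; first by rewrite conjg1 mulg1.
  rewrite expgSr conjgM IH conjMg conjXg.
  have -> : [~ x, y] ^ y = [~ x, y] by rewrite conjgE kC mulKg.
  by rewrite expgS mulgA; congr (_ * _); rewrite commgEl mulVKg.
rewrite commgEl conjXg xJ expgMn; last by apply: commuteX; apply/commute_sym/kC.
by rewrite mulKg -expgnA mulnC.
Qed.

Variable S : set G.
Hypothesis SM : forall g h, S g -> S h -> S (g * h).
Hypothesis S_onto : forall g, exists2 s, S s & exists m, g = s * zexpg [~ x, y] m.

Lemma semigroup_central_commutator g : S g.
Proof.
set k := [~ x, y]; pose z := zexpg k.
have zC m h : commute (z m) h by apply: zexpg_central; exact: kC.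
have zV m : (z m)^-1 = z (- m)%R.
  by apply: (mulgI (z m)); rewrite mulgV -zexpgD subrr.
have pick h : exists m, S (h * z m).
  have [s Ss [m hE]] := S_onto h; exists (- m)%R.
  by rewrite -zV hE -[zexpg _ m]/(z m) mulgK.
have SX h n : S h -> S (h ^+ n.+1).
  by move=> Sh; elim: n => [|n IH]; rewrite ?expg1 // expgS; exact: SM.
suff Sz : forall m, S (z m).
  have [s Ss [m ->]] := S_onto g; exact: SM.
have [p1 S1] := pick x; have [p2 S2] := pick x^-1.
have [q1 S3] := pick y; have [q2 S4] := pick y^-1.
have zX m n : (z m) ^+ n = z (m *+ n)%R by exact: zexpg_natr.
have mv h m h' m' : (h * z m) * (h' * z m') = (h * h') * z (m + m')%R.
  by rewrite /z zexpgD -!mulgA; congr (_ * _); rewrite !mulgA; congr (_ * _); exact: zC.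
have XE h m n : (h * z m) ^+ n = h ^+ n * z (m *+ n)%R.
  by rewrite expgMn ?zX //; apply/commute_sym/zC.
(* The lifts of [x] and [x^-1] to [S] multiply to [z (p1 + p2)], those of [y] and [y^-1] to
   [z (q1 + q2)]. *)
apply: (@addclosed_quadratic (fun m => S (z m)) _ (p1 + p2)%R (q1 + q2)%R).
- by move=> a b Sa Sb; rewrite /z zexpgD; exact: SM.
- by have := SM S1 S2; rewrite mv mulgV mul1g.
- by have := SM S3 S4; rewrite mv mulgV mul1g.
- move=> a b.
  (* Up to central factors this word is [[~ x ^+ a.+1, y ^+ b.+1]]; the order used in the last case
     gives the inverse commutator. *)
  have := SM (SM (SX _ a S2) (SX _ b S4)) (SM (SX _ a S1) (SX _ b S3)).
  rewrite !XE !mv.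
  have -> : x^-1 ^+ a.+1 * y^-1 ^+ b.+1 * (x ^+ a.+1 * y ^+ b.+1) = z (Posz (a.+1 * b.+1)%N).
    by rewrite !expVgn -[RHS]commXX_central commgEl conjgE !mulgA.
  by rewrite /z -zexpgD; congr (S (zexpg _ _)); rewrite !mulrnDl; ring.
- move=> a b.
  have := SM (SM (SX _ b S4) (SX _ a S2)) (SM (SX _ b S3) (SX _ a S1)).
  rewrite !XE !mv.
  have -> : y^-1 ^+ b.+1 * x^-1 ^+ a.+1 * (y ^+ b.+1 * x ^+ a.+1) =
      z (- (a.+1 * b.+1)%N%:Z)%R.
    rewrite !expVgn -zV -[z _]commXX_central [[~ x ^+ _, _]]commgEl conjgE.
    by rewrite !invgM !invgK !mulgA.
  by rewrite /z -zexpgD; congr (S (zexpg _ _)); rewrite !mulrnDl; ring.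
Qed.

End CentralCommutator.

(** * Subsemigroups of nilpotent groups *)

Section LowerCentral.
Variable G : groupType.
Local Open Scope group_scope.

Lemma commMgJ (x y g : G) : [~ x * y, g] = [~ x, g] ^ y * [~ y, g].
Proof. by rewrite !commgEl !conjgE !invgM !mulgA !mulgK. Qed.

Lemma commgMJ (x g h : G) : [~ x, g * h] = [~ x, h] * [~ x, g] ^ h.
Proof. by rewrite !commgEl !conjgE !invgM !mulgA !mulgK. Qed.

Lemma commVgJ (x g : G) : [~ x^-1, g] = ([~ x, g] ^ x^-1)^-1.
Proof. by rewrite !commgEl !conjgE !invgM !invgK !mulgA ?mulgK ?mulgV ?mul1g. Qed.

Lemma commgVJ (x g : G) : [~ x, g^-1] = ([~ x, g] ^ g^-1)^-1.
Proof. by rewrite !commgEl !conjgE !invgM !invgK !mulgA ?mulgK ?mulgV ?mul1g. Qed.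

Lemma subgroup_genS (A : set G) (M : normal_subgroup G) :
  (forall x, A x -> M x) -> forall x, subgroup_gen A x -> M x.
Proof.
move=> AM x; elim=> [y /AM //||y z _ My _ Mz|y _ My].
- exact: nsub1.
- exact: nsubM.
- exact: nsubV.
Qed.

Lemma subgroup_gen_conj (A : set G) :
  (forall x g, A x -> subgroup_gen A (x ^ g)) ->
  forall x g, subgroup_gen A x -> subgroup_gen A (x ^ g).
Proof.
move=> AJ x g; elim=> [y /AJ //||y z _ My _ Mz|y _ My].
- by rewrite conj1g; exact: sgen_one.
- by rewrite conjMg; exact: sgen_mul.
- by rewrite conjVg; exact: sgen_inv.
Qed.

Definition gen_normal (A : set G)
    (AJ : forall x g, A x -> subgroup_gen A (x ^ g)) : normal_subgroup G :=
  NormalSubgroup (@sgen_one _ A) (@sgen_mul _ A) (@sgen_inv _ A)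
    (subgroup_gen_conj AJ).

Lemma lower_central_conj i (x g : G) :
  lower_central i x -> lower_central i (x ^ g).
Proof.
elim: i x g => [|i IH] x g //=; apply: subgroup_gen_conj => {x g} z g [x [y [xi ->]]].
apply: sgen_in; exists (x ^ g), (y ^ g); split; first exact: IH.
by rewrite conjRg.
Qed.

Lemma lower_central1 i : @lower_central G i 1.
Proof. by case: i => //= i; exact: sgen_one. Qed.

Lemma lower_centralM i (x y : G) :
  lower_central i x -> lower_central i y -> lower_central i (x * y).
Proof. by case: i => //= i; exact: sgen_mul. Qed.

Lemma lower_centralV i (x : G) : lower_central i x -> lower_central i x^-1.
Proof. by case: i => //= i; exact: sgen_inv. Qed.

Definition lcn i : normal_subgroup G :=
  NormalSubgroup (@lower_central1 i) (@lower_centralM i) (@lower_centralV i)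
    (@lower_central_conj i).

Lemma lcn_comm i x y : lcn i x -> lcn i.+1 [~ x, y].
Proof. by move=> xi; apply: sgen_in; exists x, y. Qed.

(** This expresses generation by [F] modulo [L] inside [G], without passing to a quotient. *)
Definition relgen (F : seq G) (L : set G) : set G :=
  subgroup_gen [set x | x \in F \/ L x].

Section RelGen.
Variables (L : normal_subgroup G) (F : seq G).
Hypothesis FL : forall k g, k \in F -> L [~ k, g].

(** For [x] in [F], [x ^ g] is [x * [~ x, g]] with second factor in [L]. *)
Lemma relgen_conj x g : x \in F \/ L x -> relgen F L (x ^ g).
Proof.
case=> [xF|Lx]; last by apply: sgen_in; right; exact: nsubJ.
rewrite -(mulVKg x (x ^ g)) -commgEl.
by apply: sgen_mul; apply: sgen_in; [left|right; exact: FL].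
Qed.

Definition relgen_normal : normal_subgroup G := gen_normal relgen_conj.

End RelGen.

(** The subgroup on the right is normal, so the expansions of commutators of products and inverses
    reduce both entries to generators. Generators taken from [lcn j.+1] contribute only elements of
    [lcn j.+2]. *)
Lemma lower_central_commutators (s F : seq G) j :
  (forall x, subgroup_gen [set y | y \in s] x) ->
  (forall f, f \in F -> lcn j f) ->
  (forall x, lcn j x -> relgen F (lcn j.+1) x) ->
  forall x, lcn j.+1 x ->
    relgen [seq [~ f, y] | f <- F, y <- s] (lcn j.+2) x.
Proof.
move=> sG Fj jF; set F' := [seq _ | f <- F, y <- s].
have F'L k g : k \in F' -> lcn j.+2 [~ k, g].
  by move=> /allpairsP[[f y] /= [fF ys ->]]; exact: (lcn_comm _ (lcn_comm _ (Fj _ fF))).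
pose M := relgen_normal F'L.
apply: (@subgroup_genS _ M) => _ [x [y [/jF xj ->]]].
elim: xj y => {x} [x [xF|xj]||x x' _ IH _ IH'|x _ IH] y.
- elim: (sG y) => {y} [y ys||y y' _ IH _ IH'|y _ IH].
  + by apply: sgen_in; left; apply/allpairsP; exists (x, y).
  + by rewrite commg1; exact: (nsub1 M).
  + by rewrite commgMJ; apply: (nsubM (n := M)) => //; exact: (nsubJ (n := M)).
  + by rewrite commgVJ; apply: (nsubV (n := M)); exact: (nsubJ (n := M)).
- by apply: sgen_in; right; exact: lcn_comm.
- by rewrite comm1g; exact: (nsub1 M).
- by rewrite commMgJ; apply: (nsubM (n := M)) => //; exact: (nsubJ (n := M)).
- by rewrite commVgJ; apply: (nsubV (n := M)); exact: (nsubJ (n := M)).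
Qed.

Lemma lower_central_fg (s : seq G) j :
  (forall x, subgroup_gen [set y | y \in s] x) ->
  exists2 F : seq G, (forall f, f \in F -> lcn j f) &
    forall x, lcn j x -> relgen F (lcn j.+1) x.
Proof.
move=> sG; elim: j => [|j [F Fj jF]].
  exists s => // x _; elim: (sG x) => {x} [x xs||x y _ Hx _ Hy|x _ Hx].
  - by apply: sgen_in; left.
  - exact: sgen_one.
  - exact: sgen_mul.
  - exact: sgen_inv.
exists [seq [~ f, y] | f <- F, y <- s].
  by move=> _ /allpairsP[[f y] /= [fF ys ->]]; exact: (lcn_comm _ (Fj _ fF)).
exact: lower_central_commutators.
Qed.

Section Semigroup.
Variable S : set G.
Hypothesis SM : forall g h, S g -> S h -> S (g * h).

Definition onto_mod (M : set G) := forall g, exists2 s, S s & M (s^-1 * g).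

(** In the quotient by the subgroup that [F] and [L] generate, [[~ x, y]] is central and the larger
    subgroup maps into its powers, so [semigroup_central_commutator] applies to the image of [S]. *)
Lemma onto_mod_remove (L : normal_subgroup G) (F : seq G) (x y : G) :
  (forall k g, k \in [~ x, y] :: F -> L [~ k, g]) ->
  onto_mod (relgen ([~ x, y] :: F) L) -> onto_mod (relgen F L).
Proof.
move=> kFL So.
have FL k g : k \in F -> L [~ k, g].
  by move=> kF; apply: kFL; rewrite in_cons kF orbT.
pose M := relgen_normal FL.
have LM z : L z -> M z by move=> Lz; apply: sgen_in; right.
have FM z : z \in F -> M z by move=> zF; apply: sgen_in; left.
pose p := @qproj G M.
have pz u : relgen ([~ x, y] :: F) L u -> exists m, p u = zexpg [~ p x, p y] m.
  elim=> {u} [u [|Lu]||u v _ [m um] _ [n vn]|u _ [m um]].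
  - rewrite in_cons => /orP[/eqP ->|/FM Mu]; last by exists 0%R; rewrite /p qproj1.
    by exists 1%R; rewrite /p qproj_comm.
  - by exists 0%R; rewrite /p qproj1 //; exact: LM.
  - by exists 0%R; rewrite /p qproj1 //; exact: nsub1.
  - by exists (m + n)%R; rewrite zexpgD -um -vn /p qproj_mul.
  - exists (- m)%R; apply: (mulgI (p u)).
    by rewrite /p -qproj_mul mulgV -/(p u) um -zexpgD subrr qproj1 //; exact: nsub1.
have kC a : commute [~ p x, p y] a.
  rewrite -(qprojK a) -/(p _) -qproj_comm; apply/commgP/eqP.
  by rewrite -qproj_comm qproj1 //; apply/LM/kFL; rewrite mem_head.
move=> g; suff [s Ss pE] : [set a | exists2 s, S s & p s = a] (p g).
  by exists s => //; exact: (@qproj_inj _ M).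
apply: (semigroup_central_commutator kC) => [_ _ [s Ss <-] [t St <-]|a].
  by exists (s * t); [exact: SM|rewrite /p qproj_mul].
rewrite -(qprojK a) -/(p _); have [s Ss /pz[m pm]] := So (qval a).
exists (p s); first by exists s.
by exists m; rewrite -pm /p -qproj_mul mulVKg.
Qed.

Lemma onto_mod_relgen (L : normal_subgroup G) (F : seq G) :
  (forall k g, k \in F -> L [~ k, g]) ->
  (forall k, k \in F -> exists x y, k = [~ x, y]) ->
  onto_mod (relgen F L) -> onto_mod L.
Proof.
elim: F => [|k F IH] FL Fc So.
  move=> g; have [s Ss sg] := So g; exists s => //.
  by apply: subgroup_genS sg => x [].
apply: IH => [z g zF|z zF|]; first by apply: FL; rewrite in_cons zF orbT.
  by apply: Fc; rewrite in_cons zF orbT.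
have [x [y kE]] := Fc k (mem_head _ _).
by rewrite kE in FL So; exact: onto_mod_remove So.
Qed.

Lemma semigroup_onto_abelianization :
  finitely_generated G -> nilpotent G -> onto_mod (lower_central 1) ->
  forall g, S g.
Proof.
move=> [s sG] [c Gc] S1 g.
(* Term [c] is trivial, hence so are the commutators generating term [c.+1]. The shift by one lets
   the induction start at the abelianization, even when [c = 0]. *)
have {S1} /(_ g)[t St tg] : onto_mod (lcn c.+1).
  elim: c {Gc} => [|c IH]; first exact: S1.
  have [F Fc cF] := lower_central_fg c sG.
  apply: (@onto_mod_relgen (lcn c.+2) [seq [~ f, y] | f <- F, y <- s]).
  - by move=> k h /allpairsP[[f y] /= [fF ys ->]]; exact: (lcn_comm _ (lcn_comm _ (Fc _ fF))).
  - by move=> k /allpairsP[[f y] /= [fF ys ->]]; exists f, y.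
  move=> h; have [t St th] := IH h; exists t => //.
  exact: (lower_central_commutators sG Fc cF).
suff tg1 : t^-1 * g = 1 by rewrite -(mulVKg t g) tg1 mulg1.
elim: tg => [_ [x [y [/Gc -> ->]]]||x y _ -> _ ->|x _ ->].
- exact: comm1g.
- by [].
- exact: mulg1.
- exact: invg1.
Qed.

End Semigroup.
End LowerCentral.

(** * Integer relations in finitely generated abelian groups *)

Section Relations.
Local Open Scope ring_scope.

Lemma int_left_kernel (d : nat) (M : 'M[int]_(d.+1, d)) :
  exists2 a : 'rV[int]_d.+1, a != 0 & a *m M = 0.
Proof.
pose Q : 'M[rat]_(d.+1, d) := map_mx intr M.
have K0 : kermx Q != 0.
  rewrite kermx_eq0 /row_free; apply/eqP => rQ.
  by have := rank_leq_col Q; rewrite rQ ltnn.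
pose v := nz_row (kermx Q).
have v0 : v != 0 by rewrite nz_row_eq0.
have vQ : v *m Q = 0 by apply/sub_kermxP; exact: nz_row_sub.
pose den (i : 'I_d.+1) := denq (v 0 i).
(* A rational kernel vector [v] exists by counting dimensions; [a] is [v] times the product of all
   denominators of its entries. *)
pose a : 'rV[int]_d.+1 := \row_i (numq (v 0 i) * \prod_(j | j != i) den j).
pose c : rat := (\prod_j den j)%:~R.
have c0 : c != 0.
  by rewrite intr_eq0; apply/prodf_neq0 => i _; exact: denq_neq0.
have aE i : (a 0 i)%:~R = v 0 i * c.
  have -> : a 0 i = numq (v 0 i) * \prod_(j | j != i) den j by rewrite mxE.
  have cE : c = (den i)%:~R * (\prod_(j | j != i) den j)%:~R.
    by rewrite /c [in LHS](bigD1 i) //= intrM.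
  rewrite cE intrM mulrA; congr (_ * _).
  rewrite -[v 0 i in RHS]divq_num_den divfK //.
  by rewrite intr_eq0 denq_neq0.
exists a.
  apply: contra_neq v0 => a0; apply/rowP => i.
  have /eqP := aE i; rewrite a0 !mxE eq_sym mulf_eq0 (negPf c0) orbF.
  by move/eqP.
apply/rowP => j; apply/eqP; rewrite !mxE -(intr_eq0 rat) rmorph_sum /=.
under eq_bigr do rewrite rmorphM /= aE mulrAC.
rewrite -mulr_suml.
have : (v *m Q) 0 j = 0 by rewrite vQ mxE.
rewrite mxE => vQj; rewrite (eq_bigr (fun i => v 0 i * Q i j)).
  by rewrite vQj mul0r.
by move=> i _; rewrite mxE.
Qed.

(** Coordinates of the [z i] in terms of the [g j] form a [d + 1] by [d] integer matrix, and a
    vector of its left kernel is a relation. *)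
Lemma fg_int_relation (A : zmodType) (d : nat) (g : 'I_d -> A) :
  (forall x, exists e : 'I_d -> int, x = \sum_j g j *~ e j) ->
  forall z : 'I_d.+1 -> A, exists2 a : 'I_d.+1 -> int,
    (exists i, a i != 0) & \sum_i z i *~ a i = 0.
Proof.
move=> gA z; have [e zE] := choice (fun i => gA (z i)).
have [a a0 aM] := int_left_kernel (\matrix_(i, j) e i j).
exists (fun i => a 0 i).
  apply: contrapT => h; move/negP: a0; apply; apply/eqP/rowP => i; rewrite mxE.
  by apply/eqP; apply: contrapT => /negP ai; apply: h; exists i.
under eq_bigr do rewrite zE mulrz_suml.
rewrite exchange_big /= big1 // => j _.
under eq_bigr do rewrite -mulrzA.
rewrite -mulrz_sumr; have /rowP/(_ j) := aM; rewrite !mxE => aMj.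
rewrite (_ : \sum_i _ = 0) ?mulr0z // -[RHS]aMj.
by apply: eq_bigr => i _; rewrite mxE mulrC.
Qed.

End Relations.

(** * Ultrafilters and sign patterns *)

Section UltraPower.
Variables (A : Type) (p : set_system A).
Hypothesis pU : UltraFilter p.

(** Otherwise [p] contains the complement of every [P i], hence their finite intersection, which is
    disjoint from the given set. *)
Lemma ultra_exists (I : finType) (P : I -> set A) :
  p [set z | exists i, P i z] -> exists i, p (P i).
Proof.
move=> pP; apply: contrapT => nP.
have : p [set z | forall i, ~ P i z].
  apply: filter_forall => i.
  by have [pi|//] := in_ultra_setVsetC (P i) pU; case: nP; exists i.
move=> /(filterI pP)/filter_ex[z [[i Piz] /(_ i)]].
exact.
Qed.

(* Quantification over the [k]-th tensor power of [p]. *)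
Fixpoint pall (k : nat) (P : seq A -> Prop) : Prop :=
  if k is k'.+1 then p [set z | pall k' (fun l => P (z :: l))] else P [::].

Lemma pall_exists (I : finType) k (P : I -> seq A -> Prop) :
  pall k (fun l => exists i, P i l) -> exists i, pall k (P i).
Proof.
elim: k P => [|k IH] P //= pP; apply: (@ultra_exists _ (fun i => [set z | _])).
by apply: filterS pP => z /IH.
Qed.

Lemma pall_true k (P : seq A -> Prop) :
  (forall l, size l = k -> P l) -> pall k P.
Proof.
elim: k P => [|k IH] P PT /=; first exact: PT.
by apply: filterE => z; apply: IH => l lk; apply: PT; rewrite /= lk.
Qed.

End UltraPower.

Section SignPattern.
Local Open Scope ring_scope.
Variables (A : zmodType) (d : nat) (g : 'I_d -> A).
Hypothesis gA : forall x, exists e : 'I_d -> int, x = \sum_j g j *~ e j.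
Variable p : set_system A.
Hypothesis pU : UltraFilter p.

Definition sgo (b : bool) (x : A) := if b then - x else x.

(** An integer relation with the signs of its coefficients split off: the signs range over a finite
    type and can be fixed on generic tuples, while the absolute values [n] may vary with the
    tuple. *)
Definition sign_relation (s : {ffun 'I_d.+1 -> bool}) (z : seq A) :=
  exists2 n : 'I_d.+1 -> nat, (exists i, 0 < n i)%N &
    \sum_i sgo (s i) z`_i *+ n i = 0.

Lemma sign_relation_pall : exists s, pall p d.+1 (sign_relation s).
Proof.
apply: (pall_exists pU); apply: (pall_true pU) => z _.
have [a [i ai] az] := fg_int_relation gA (fun i => z`_i).
exists [ffun i => a i < 0]; exists (fun i => `|a i|%N).
  by exists i; rewrite absz_gt0.
rewrite -[RHS]az; apply: eq_bigr => j _; rewrite ffunE /sgo.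
case: (a j) => m; first by rewrite absz_nat.
by rewrite NegzE mulrNz abszN absz_nat mulNrn.
Qed.

Variable T : set A.
Hypothesis TD : forall x y, T x -> T y -> T (x + y).

Lemma addclosed_sum (k : nat) (y : 'I_k -> A) (n : 'I_k -> nat) :
  (forall i, T (y i)) -> (exists i, 0 < n i)%N -> T (\sum_i y i *+ n i).
Proof.
move=> Ty [i0 n0].
have Tn x m : T x -> T (x *+ m.+1).
  by move=> Tx; elim: m => [|m IH]; rewrite ?mulr1n // mulrS; exact: TD.
(* Indices with [n i = 0] contribute [0], which [T] need not contain; the term at [i0] brings the
   sum back into [T]. *)
pose T0 x := x = 0 \/ T x.
have T0D x y' : T0 x -> T0 y' -> T0 (x + y').
  move=> [->|Tx]; first by rewrite add0r.
  by move=> [->|Ty']; right; rewrite ?addr0 //; exact: TD.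
have T0s : T0 (\sum_(i | i != i0) y i *+ n i).
  apply: (big_ind T0) => //; first by left.
  by move=> i _; case: (n i) => [|m]; [left|right; exact: Tn].
rewrite (bigD1 i0) //=; case: (n i0) n0 => // m _.
by case: T0s => [->|Ts]; rewrite ?addr0; [|apply: TD => //]; exact: Tn.
Qed.

(** The tuple is built entry by entry: a prefix with generic continuations is extended by an [x] for
    which [sgo b x + c] is in [T]. In the weighted sum of these elements the relation cancels and a
    positive multiple of [c] remains. *)
Lemma sign_relation_multiple s (c : A) :
  pall p d.+1 (sign_relation s) ->
  (forall pre k b,
    p [set x | pall p k (fun l => sign_relation s (pre ++ x :: l))] ->
    exists2 x, pall p k (fun l => sign_relation s (pre ++ x :: l)) &
      T (sgo b x + c)) ->
  exists m, T (c *+ m.+1).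
Proof.
move=> ps hit.
have real k pre : (size pre + k = d.+1)%N ->
    pall p k (fun l => sign_relation s (pre ++ l)) ->
    (forall i : 'I_d.+1, (i < size pre)%N -> T (sgo (s i) pre`_i + c)) ->
    exists2 z, sign_relation s z & forall i : 'I_d.+1, T (sgo (s i) z`_i + c).
  elim: k pre => [|k IH] pre.
    rewrite addn0 /= cats0 => sz R Tp; exists pre => // i.
    by apply: Tp; rewrite sz.
  move=> sz /= pR Tp.
  have [x xR Tx] := hit pre k (s (inord (size pre))) pR.
  apply: (IH (rcons pre x)); first by rewrite size_rcons -sz addnS addSn.
    by under eq_fun do rewrite cat_rcons.
  move=> i; rewrite size_rcons ltnS leq_eqVlt nth_rcons => /orP[/eqP iE|ip].
    by rewrite iE ltnn eqxx; move: Tx; rewrite -iE inord_val.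
  by rewrite ip; exact: Tp.
have [//|//|//|z [n n0 zn] Tz] := real d.+1 [::].
have := addclosed_sum Tz n0.
under eq_bigr do rewrite mulrnDl.
rewrite big_split /= zn add0r sumrMnr.
case E : (\sum_i n i)%N => [|m]; last by exists m.
have [i ni] := n0; move/eqP: E; rewrite sum_nat_eq0 => /forallP/(_ i)/=.
by rewrite eqn0Ngt ni.
Qed.

End SignPattern.

(** * Events of the increment sequence *)

Local Open Scope ring_scope.

Section RealProbability.
Context {R : realType} {d : measure_display} {T : measurableType d}.
Variable P : probability T R.

Definition pr (X : set T) : R := fine (P X).

Lemma prE X : measurable X -> P X = (pr X)%:E.
Proof. by move=> mX; rewrite /pr fineK // fin_num_measure. Qed.

Lemma pr_ge0 X : 0 <= pr X.
Proof. by rewrite /pr fine_ge0. Qed.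

Lemma prT : pr setT = 1.
Proof. by rewrite /pr probability_setT. Qed.

Lemma pr0 : pr set0 = 0.
Proof. by rewrite /pr measure0. Qed.

Lemma prD A B : measurable A -> measurable B -> B `<=` A ->
  pr (A `\` B) = pr A - pr B.
Proof.
move=> mA mB BA; rewrite /pr measureD //; last by rewrite -ge0_fin_numE// fin_num_measure.
by rewrite (setIidr BA) fineB // fin_num_measure.
Qed.

Lemma pr_le A B : measurable A -> measurable B -> B `<=` A -> pr B <= pr A.
Proof. by move=> mA mB BA; rewrite -subr_ge0 -prD // pr_ge0. Qed.

Lemma prC A : measurable A -> pr (~` A) = 1 - pr A.
Proof. by move=> mA; rewrite -setTD prD // prT. Qed.

Lemma pr_negligible A : measurable A -> (P.-negligible A <-> pr A = 0).
Proof.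
move=> mA; split=> [/(negligibleP P mA) A0|A0].
  by rewrite /pr (_ : P A = 0%E).
by apply/(negligibleP P mA); have := prE mA; rewrite A0.
Qed.

Lemma pr_bigcup (F : (set T)^nat) : (forall n, measurable (F n)) ->
  nondecreasing_seq F -> pr (F n) @[n --> \oo] --> pr (\bigcup_n F n).
Proof.
move=> mF ndF; have mU : measurable (\bigcup_n F n) by exact: bigcupT_measurable.
rewrite /pr; apply: fine_cvg; rewrite fineK ?fin_num_measure //.
exact: nondecreasing_cvg_mu.
Qed.

End RealProbability.

(** * The sigma-algebra of sequences generated by cylinders *)

Section SequenceSpace.
Variables (G : Type) (e : nat -> G).
Hypothesis eS : forall g, exists n, e n = g.

Definition cyl (n : nat) (f : nat -> G) : set (nat -> G) :=
  [set z | forall i, (i < n)%N -> z i = f i].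

(** The empty set is included so that the family is closed under intersection. *)
Definition cyls : set (set (nat -> G)) :=
  [set B | B = set0 \/ exists n f, B = cyl n f].

Definition mseq : set (set (nat -> G)) := <<s cyls >>.

Lemma setI_closed_cyls : setI_closed cyls.
Proof.
move=> A B [->|[n [f ->]]]; first by left; rewrite set0I.
case=> [->|[m [g ->]]]; first by left; rewrite setI0.
have [h|h] := pselect (forall i, (i < minn n m)%N -> f i = g i).
  right; exists (maxn n m), (fun i => if (i < n)%N then f i else g i).
  apply/seteqP; split=> z.
    move=> [zf zg] i; rewrite leq_max; case: ltnP => [im _|_ /= im]; first exact: zf.
    exact: zg.
  move=> zfg; split=> i im; rewrite zfg ?leq_max ?im ?orbT //.
  by case: ltnP => // ni; apply: h; rewrite leq_min im ni.
left; rewrite -subset0 => z [zf zg]; apply: h => i.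
by rewrite leq_min => /andP[i_n im]; rewrite -zf // zg.
Qed.

Lemma mseq_sigma : sigma_algebra setT mseq.
Proof. exact: smallest_sigma_algebra. Qed.

Lemma mseq0 : mseq set0.
Proof. by have [] := mseq_sigma. Qed.

Lemma mseqC B : mseq B -> mseq (~` B).
Proof. by move=> mB; rewrite -setTD; have [_ + _] := mseq_sigma; exact. Qed.

Lemma mseq_bigcup (F : (set (nat -> G))^nat) :
  (forall n, mseq (F n)) -> mseq (\bigcup_n F n).
Proof. by have [_ _] := mseq_sigma; exact. Qed.

Lemma mseq_bigcap (F : (set (nat -> G))^nat) :
  (forall n, mseq (F n)) -> mseq (\bigcap_n F n).
Proof.
move=> mF; rewrite -[X in mseq X]setCK setC_bigcap.
by apply: mseqC; apply: mseq_bigcup => n; apply: mseqC.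
Qed.

Lemma mseqD A B : mseq A -> mseq B -> mseq (A `\` B).
Proof.
move=> mA mB; rewrite setDE -[X in mseq X]setCK setCI setCK.
apply: mseqC; rewrite -bigcup2E; apply: mseq_bigcup => -[|[|n]] //=.
- exact: mseqC.
- exact: mseq0.
Qed.

Lemma mseq_cyl n f : mseq (cyl n f).
Proof. by apply: sub_sigma_algebra; right; exists n, f. Qed.

Lemma mseq_finitary n (Q : set (nat -> G)) :
  (forall z z', (forall i, (i < n)%N -> z i = z' i) -> Q z -> Q z') -> mseq Q.
Proof.
move=> Qn.
(* Since [e] reaches every element, [dec] reaches every word of length [n], and [Q] becomes a
   countable union of cylinders. *)
pose dec (k : nat) (i : nat) : G := e (nth 0%N (odflt [::] (unpickle k)) i).
have -> : Q = \bigcup_k [set z | Q (dec k) /\ cyl n (dec k) z].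
  apply/seteqP; split=> [z Qz|z [k _ [Qk zk]]]; last first.
    by apply: Qn Qk => i i_n; rewrite zk.
  have [idx idxE] := choice eS.
  exists (pickle (mkseq (idx \o z) n)) => //.
  have zE i : (i < n)%N -> z i = dec (pickle (mkseq (idx \o z) n)) i.
    by move=> i_n; rewrite /dec pickleK /= nth_mkseq //= idxE.
  by split=> //; exact: Qn Qz.
apply: mseq_bigcup => k; have [Qk|nQk] := pselect (Q (dec k)).
  rewrite (_ : [set z | _] = cyl n (dec k)); first exact: mseq_cyl.
  by apply/seteqP; split=> z // [].
rewrite (_ : [set z | _] = set0); first exact: mseq0.
by rewrite -subset0 => z [].
Qed.

Context {R : realType} {d : measure_display} {T : measurableType d}.
Variable P : probability T R.

Definition traj (z : nat -> T -> G) (w : T) : nat -> G := fun i => z i w.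

Lemma traj_measurable (z : nat -> T -> G) B :
  (forall i g, measurable [set w | z i w = g]) ->
  mseq B -> measurable (traj z @^-1` B).
Proof.
move=> mz; move: B; apply: smallest_sub.
  split=> [|B mB|F mF]; first by rewrite preimage_set0.
    by rewrite setTD preimage_setC; exact: measurableC.
  by rewrite preimage_bigcup; exact: bigcupT_measurable.
move=> _ [->|[n [f ->]]]; first by rewrite /= preimage_set0.
rewrite (_ : _ @^-1` _ = \bigcap_(i in `I_n) [set w | z i w = f i]); last first.
  by apply/seteqP; split=> w.
by apply: bigcap_measurableType => i _; exact: mz.
Qed.

Lemma pr_marginal (D D' : set T) (f f' : T -> G) (r : R) :
  measurable D -> measurable D' ->
  (forall g, measurable [set w | f w = g]) ->
  (forall g, measurable [set w | f' w = g]) ->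
  (forall g, pr P (D `&` [set w | f w = g]) =
             r * pr P (D' `&` [set w | f' w = g])) ->
  pr P D = r * pr P D'.
Proof.
move=> mD mD' mf mf' H; have [idx idxE] := choice eS.
have F E (h : T -> G) : measurable E -> (forall g, measurable [set w | h w = g]) ->
    let F n := E `&` [set w | idx (h w) = n] in
    (forall n, measurable (F n)) /\
    P E = (\sum_(n <oo) P (F n))%E.
  move=> mE mh F; have mF n : measurable (F n).
    (* As [e] may repeat values, only the index that [idx] selects for a value counts; the pieces at
       other indices are empty. *)
    apply: measurableI => //; have [en|en] := pselect (idx (e n) = n).
      rewrite (_ : [set w | _] = [set w | h w = e n]) //.
      by apply/seteqP; split=> w /=; [move=> <-; rewrite idxE|move=> ->].
    rewrite (_ : [set w | _] = set0) // -subset0 => w /= wn.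
    by apply: en; rewrite -wn idxE.
  split=> //; have {1}-> : E = \bigcup_n F n.
    by rewrite -setI_bigcupr; apply/esym/setIidl => w _; exists (idx (h w)).
  rewrite measure_bigcup //; first by apply: eq_eseriesl => n; rewrite in_setT.
  by apply/trivIsetP => i j _ _ ij; rewrite -subset0 => w [[_ /= iE] [_ /= jE]];
     move/eqP: ij; apply; rewrite -iE -jE.
have [mF PD] := F D f mD mf; have [mF' PD'] := F D' f' mD' mf'.
apply: EFin_inj; rewrite EFinM -!prE // PD PD' -nneseriesZl //.
apply: eq_eseriesr => n _; rewrite !prE // -EFinM; congr EFin.
have [en|en] := pselect (idx (e n) = n).
  have E (h : T -> G) : [set w | idx (h w) = n] = [set w | h w = e n].
    by apply/seteqP; split=> w /=; [move=> <-; rewrite idxE|move=> ->].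
  by rewrite !E.
have E (h : T -> G) : [set w | idx (h w) = n] = set0.
  by rewrite -subset0 => w /= wn; apply: en; rewrite -wn idxE.
by rewrite !E !setI0 pr0 mulr0.
Qed.

(** A pi-lambda argument on cylinders. Those shorter than [n0] are handled by summing over the next
    coordinate with [pr_marginal]. *)
Lemma pr_unique (D : set T) (z z' : nat -> T -> G) (r : R) (n0 : nat) :
  measurable D ->
  (forall i g, measurable [set w | z i w = g]) ->
  (forall i g, measurable [set w | z' i w = g]) ->
  (forall n f, (n0 <= n)%N ->
    pr P (D `&` traj z' @^-1` cyl n f) = r * pr P (traj z @^-1` cyl n f)) ->
  forall B, mseq B ->
    pr P (D `&` traj z' @^-1` B) = r * pr P (traj z @^-1` B).
Proof.
move=> mD mz mz' H.
have mB B : mseq B -> measurable (traj z @^-1` B) by exact: traj_measurable.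
have mB' B : mseq B -> measurable (D `&` traj z' @^-1` B).
  by move=> sB; apply: measurableI => //; exact: traj_measurable.
have {}H n f : pr P (D `&` traj z' @^-1` cyl n f) = r * pr P (traj z @^-1` cyl n f).
  have [m] : exists m, (n0 <= n + m)%N by exists n0; exact: leq_addl.
  elim: m n f => [|m IH] n f nm; first by apply: H; rewrite -(addn0 n).
  apply: (@pr_marginal _ _ (z' n) (z n)) => //.
  - by apply: mB'; exact: mseq_cyl.
  - by apply: mB; exact: mseq_cyl.
  move=> g; pose f' i := if i == n then g else f i.
  have E (y : nat -> T -> G) :
      traj y @^-1` cyl n f `&` [set w | y n w = g] = traj y @^-1` cyl n.+1 f'.
    apply/seteqP; split=> w /=.
      move=> [wf wg] i; rewrite ltnS leq_eqVlt /f'.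
      by case: eqP => [-> //|_ /= /wf].
    move=> wf; split; last by rewrite -[LHS]/(traj y w n) wf // /f' eqxx.
    by move=> i i_n; have := wf i (ltnW i_n); rewrite /f' ltn_eqF.
  by rewrite -setIA !E; apply: IH; rewrite addSnnS.
suff : mseq `<=` [set B | mseq B /\
    pr P (D `&` traj z' @^-1` B) = r * pr P (traj z @^-1` B)].
  by move=> sub B /sub[].
apply: lambda_system_subset => //; first exact: setI_closed_cyls; last first.
  move=> _ [->|[n [f ->]]]; last by split; [exact: mseq_cyl|exact: H].
  by split; [exact: mseq0|rewrite !preimage_set0 setI0 pr0 mulr0].
split=> //.
- have -> : [set: nat -> G] = cyl 0 (fun _ => e 0%N) by apply/seteqP; split.
  by split; [exact: mseq_cyl|exact: H].
- move=> A B BA [sA HA] [sB HB]; split; first exact: mseqD.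
  have -> : D `&` traj z' @^-1` (A `\` B) =
      (D `&` traj z' @^-1` A) `\` (D `&` traj z' @^-1` B).
    apply/seteqP; split=> w /=; first by move=> [Dw [Aw nBw]]; split=> // -[].
    by move=> [[Dw Aw] nB]; split=> //; split=> // Bw; apply: nB.
  have -> : traj z @^-1` (A `\` B) = traj z @^-1` A `\` traj z @^-1` B by [].
  rewrite !prD ?HA ?HB ?mulrBr //; try (by [apply: mB'|apply: mB]).
  + by move=> w; exact: BA.
  + by move=> w [Dw Bw]; split=> //; exact: BA.
- move=> F ndF HF; have sU : mseq (\bigcup_n F n).
    by apply: mseq_bigcup => n; case: (HF n).
  split=> //.
  have ndz : nondecreasing_seq (fun n => traj z @^-1` F n).
    by move=> m n mn; rewrite subsetEset => w; have /subsetPset := ndF _ _ mn; exact.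
  have ndz' : nondecreasing_seq (fun n => D `&` traj z' @^-1` F n).
    move=> m n mn; rewrite subsetEset => w [Dw Fw]; split=> //.
    by have /subsetPset := ndF _ _ mn; exact.
  have := @pr_bigcup _ _ _ P _ (fun n => mB _ (HF n).1) ndz.
  have := @pr_bigcup _ _ _ P _ (fun n => mB' _ (HF n).1) ndz'.
  rewrite -setI_bigcupr -[X in D `&` X]preimage_bigcup => c1.
  rewrite -[X in pr P X]preimage_bigcup => c2.
  have {}c2 : r * pr P (traj z @^-1` F n) @[n --> \oo] -->
      r * pr P (traj z @^-1` \bigcup_n F n).
    by apply: cvgM => //; exact: cvg_cst.
  have E : (fun n => pr P (D `&` traj z' @^-1` F n)) =
      (fun n => r * pr P (traj z @^-1` F n)).
    by apply/funext => n; case: (HF n).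
  by rewrite E in c1; exact: (cvg_unique _ c1 c2).
Qed.

End SequenceSpace.

(** * The zero-one law *)

Section RandomWalk.
Variables (G : groupType) (e : nat -> G).
Hypothesis eS : forall g, exists n, e n = g.
Context {R : realType} {d : measure_display} {T : measurableType d}.
Variables (P : probability T R) (mu : G -> R) (zeta : nat -> T -> G).
Hypothesis mu_ge0 : forall g, 0 <= mu g.
Hypothesis mu_sym : symmetric_measure mu.
Hypothesis mu_gen : forall x, subgroup_gen [set g | 0 < mu g] x.
Hypothesis zeta_iid : iid_with_law P mu zeta.

Let mzeta : forall i g, measurable [set w | zeta i w = g].
Proof. by case: zeta_iid. Qed.

Let mpre B : mseq B -> measurable (traj zeta @^-1` B).
Proof. exact: traj_measurable. Qed.

Lemma pr_cyl n f :
  pr P (traj zeta @^-1` cyl n f) = \prod_(i < n) mu (f i).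
Proof. by rewrite /pr; case: zeta_iid => _ ->; rewrite big_mkord. Qed.

(** [bump N] skips the index [N]: the remaining increments have the same joint law as before and are
    independent of the removed one. *)
Lemma pr_delete (N : nat) (g : G) (B : set (nat -> G)) : mseq B ->
  pr P ([set w | zeta N w = g] `&`
        traj (fun i => zeta (bump N i)) @^-1` B) =
  mu g * pr P (traj zeta @^-1` B).
Proof.
apply: (pr_unique eS (n0 := N)) => // n f Nn.
pose f' j := if j == N then g else f (unbump N j).
rewrite (_ : _ `&` _ = traj zeta @^-1` cyl n.+1 f').
  have Nn' : (N < n.+1)%N by rewrite ltnS.
  rewrite !pr_cyl (bigD1_ord (Ordinal Nn')) //= /f' eqxx; congr (_ * _).
  by apply: eq_bigr => i _; rewrite bumpK /= eq_sym (negPf (neq_bump _ _)).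
apply/seteqP; split=> w /=.
  move=> [wN wf] j jn; rewrite /f'; case: eqP => [-> //|/eqP jN].
  rewrite -wf /traj; first by rewrite unbumpK // inE /= eq_sym.
  by rewrite /unbump; move: jN jn Nn; lia.
move=> wf; split; first by rewrite -[LHS]/(traj zeta w N) wf // /f' eqxx.
move=> i i_n; rewrite /traj -[LHS]/(traj zeta w (bump N i)) wf.
  by rewrite /f' bumpK eq_sym (negPf (neq_bump _ _)).
by rewrite /bump; move: i_n; lia.
Qed.

Lemma pr_letter N g : pr P [set w | zeta N w = g] = mu g.
Proof.
have := @pr_delete N g setT; rewrite !preimage_setT setIT prT mulr1; apply.
by rewrite -setC0; apply: mseqC; exact: mseq0.
Qed.

Lemma mu_le1 g : mu g <= 1.
Proof.
rewrite -(pr_letter 0 g) -(prT P); exact: pr_le.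
Qed.

(** The Markov property at the fixed time [k]. *)
Lemma pr_shift (k : nat) (s : nat -> G) (B : set (nat -> G)) : mseq B ->
  pr P (traj zeta @^-1` cyl k s `&` traj (fun i => zeta (k + i)%N) @^-1` B) =
  pr P (traj zeta @^-1` cyl k s) * pr P (traj zeta @^-1` B).
Proof.
apply: (pr_unique eS (n0 := 0)) => //; first by apply: mpre; exact: mseq_cyl.
move=> n f _; pose f' j := if (j < k)%N then s j else f (j - k)%N.
rewrite (_ : _ `&` _ = traj zeta @^-1` cyl (k + n) f').
  rewrite !pr_cyl big_split_ord /=; congr (_ * _); apply: eq_bigr => i _.
    by rewrite /f' ltn_ord.
  by rewrite /f' ltnNge leq_addr /= addKn.
apply/seteqP; split=> w /=.
  move=> [ws wf] j jkn; rewrite /f'; case: ltnP => [/ws //|kj].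
  by rewrite -wf /traj ?subnKC // ltn_subLR.
move=> wf; split=> i ik.
  by rewrite wf /f' ?ik // ltn_addr.
have := wf (k + i)%N; rewrite ltn_add2l => /(_ ik) wE.
by rewrite /traj -[LHS]/(traj zeta w (k + i)%N) wE /f' ltnNge leq_addr /= addKn.
Qed.

(** For a cylinder, independence is exact once [N] reaches its length; the limit then passes to
    differences and increasing unions. *)
Lemma pr_mixing g B : mseq B ->
  pr P (traj zeta @^-1` B `&` [set w | zeta N w = g]) @[N --> \oo] -->
  mu g * pr P (traj zeta @^-1` B).
Proof.
move: B; suff sub : @mseq G `<=` [set B | mseq B /\
    pr P (traj zeta @^-1` B `&` [set w | zeta N w = g]) @[N --> \oo] -->
    mu g * pr P (traj zeta @^-1` B)] by move=> B /sub[].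
have mI C N : mseq C -> measurable (traj zeta @^-1` C `&` [set w | zeta N w = g]).
  by move=> sC; apply: measurableI; [exact: mpre|exact: mzeta].
apply: lambda_system_subset => //; first exact: setI_closed_cyls; last first.
  move=> _ [->|[n [f ->]]].
    split; first exact: mseq0.
    under eq_fun do rewrite preimage_set0 set0I pr0.
    by rewrite preimage_set0 pr0 mulr0; exact: cvg_cst.
  split; first exact: mseq_cyl.
  apply: cvg_near_cst; exists n => // N /= nN.
  rewrite setIC -(@pr_delete N); last exact: mseq_cyl.
  congr (pr P (_ `&` _)); apply/seteqP; split=> w wf i i_n.
    by rewrite /traj /bump leqNgt (leq_trans i_n nN) add0n; exact: wf.
  have := wf i i_n.
  by rewrite /traj /bump leqNgt (leq_trans i_n nN) add0n.
split=> //.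
- split; first by rewrite -setC0; apply: mseqC; exact: mseq0.
  under eq_fun do rewrite preimage_setT setTI pr_letter.
  by rewrite preimage_setT prT mulr1; exact: cvg_cst.
- move=> C B BC [sC HC] [sB HB]; split; first exact: mseqD.
  have -> : traj zeta @^-1` (C `\` B) = traj zeta @^-1` C `\` traj zeta @^-1` B by [].
  rewrite prD ?mulrBr; [|exact: mpre|exact: mpre|by move=> w; exact: BC].
  have E N : pr P ((traj zeta @^-1` C `\` traj zeta @^-1` B) `&` [set w | zeta N w = g]) =
      pr P (traj zeta @^-1` C `&` [set w | zeta N w = g]) -
      pr P (traj zeta @^-1` B `&` [set w | zeta N w = g]).
    rewrite -prD; [|exact: mI|exact: mI|by move=> w [/BC]].
    congr (pr P _); apply/seteqP; split=> w /=.
      by move=> [[Cw nBw] wg]; split=> // -[].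
    by move=> [[Cw wg] nB]; split=> //; split=> // Bw; apply: nB.
  by under eq_fun do rewrite E; exact: cvgB.
- move=> F ndF HF; have sU : mseq (\bigcup_n F n).
    by apply: mseq_bigcup => n; case: (HF n).
  split=> //; set U := \bigcup_n F n.
  have ndz : nondecreasing_seq (fun n => traj zeta @^-1` F n).
    by move=> m n mn; rewrite subsetEset => w; have /subsetPset := ndF _ _ mn; exact.
  have cF := @pr_bigcup _ _ _ P _ (fun n => mpre (HF n).1) ndz.
  rewrite -[X in pr P X]preimage_bigcup -/U in cF.
  apply/cvgrPdist_lt => eps eps0.
  have eps3 : 0 < eps / 3 by rewrite divr_gt0.
  have /cvgrPdist_lt/(_ _ eps3)[n _ /(_ n (leqnn n))/= Fn] := cF.
  have [sFn /cvgrPdist_lt/(_ _ eps3)] := HF n.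
  apply: filterS => N /= HN.
  have FU : traj zeta @^-1` F n `<=` traj zeta @^-1` U by move=> w Fw; exists n.
  have l1 : pr P (traj zeta @^-1` F n) <= pr P (traj zeta @^-1` U).
    by apply: pr_le => //; exact: mpre.
  have l2 : pr P (traj zeta @^-1` F n `&` [set w | zeta N w = g]) <=
            pr P (traj zeta @^-1` U `&` [set w | zeta N w = g]).
    by apply: pr_le; [exact: mI|exact: mI|move=> w [/FU]].
  (* Replacing [U] by [F n] costs at most the probability of their difference, uniformly in [N]. *)
  have l3 : pr P (traj zeta @^-1` U `&` [set w | zeta N w = g]) -
            pr P (traj zeta @^-1` F n `&` [set w | zeta N w = g]) <=
            pr P (traj zeta @^-1` U) - pr P (traj zeta @^-1` F n).
    rewrite -!prD; [|exact: mpre|exact: mpre|exact: FU|exact: mI|exact: mI|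
      by move=> w [/FU]].
    apply: pr_le; [by apply: measurableD; exact: mpre| |].
      by apply: measurableD; exact: mI.
    by move=> w [[Uw wg] nF]; split=> // Fw; apply: nF.
  have g0 := mu_ge0 g; have g1 := mu_le1 g.
  move: HN Fn l1 l2 l3; rewrite !ltr_norml.
  set a := pr P _; set b := pr P _; set a' := pr P _; set b' := pr P _.
  move=> /andP[h1 h2] /andP[h3 h4] l1 l2 l3.
  have : 0 <= mu g * (a' - a) <= a' - a.
    by rewrite mulr_ge0 ?subr_ge0 // ler_piMl // subr_ge0.
  by rewrite mulrBr => /andP[h5 h6]; apply/andP; split; lra.
Qed.

(** The event is disjoint from [zeta N = g] for all [N >= n], so the limit in [pr_mixing] is
    zero. *)
Lemma letter_infinitely_often g n : 0 < mu g ->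
  pr P [set w | forall m, (n <= m)%N -> zeta m w <> g] = 0.
Proof.
move=> g0; pose B := [set z : nat -> G | forall m, (n <= m)%N -> z m <> g].
have sB : mseq B.
  rewrite (_ : B = \bigcap_m [set z : nat -> G | (n <= m)%N -> z m <> g]).
    apply: mseq_bigcap => m; apply: (mseq_finitary eS (n := m.+1)).
    by move=> z z' zz' /= h nm; rewrite -zz' //; exact: h.
  by apply/seteqP; split=> z Bz m *; apply: Bz.
have := @pr_mixing g _ sB.
have c0 : pr P (traj zeta @^-1` B `&` [set w | zeta N w = g]) @[N --> \oo] --> (0 : R).
  apply: cvg_near_cst; exists n => // N /= nN.
  rewrite (_ : _ `&` _ = set0) ?pr0 // -subset0 => w [/= wB wg].
  exact: (wB N).
move=> c1; have /eqP : mu g * pr P (traj zeta @^-1` B) = 0.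
  exact: (cvg_unique _ c1 c0).
by rewrite mulf_eq0 => /orP[/eqP g00|/eqP //]; rewrite g00 ltxx in g0.
Qed.

Variables (A : zmodType) (phi : G -> A).
Hypothesis phiM : forall x y, phi (x * y)%g = phi x + phi y.
Hypothesis phi_surj : forall a, exists x, phi x = a.

Lemma phi1 : phi 1%g = 0.
Proof. by apply: (addrI (phi 1%g)); rewrite -phiM mulg1 addr0. Qed.

Lemma phiV x : phi x^-1%g = - phi x.
Proof. by apply: (addrI (phi x)); rewrite -phiM mulgV phi1 subrr. Qed.

Lemma phi_prod (z : nat -> G) m :
  phi (\prod_(0 <= i < m) z i)%g = \sum_(i < m) phi (z i).
Proof.
elim: m => [|m IH]; first by rewrite big_geq // phi1 big_ord0.
by rewrite big_nat_recr //= phiM IH big_ord_recr.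
Qed.

(** A set of increment sequences rather than of sample points, so that it can be evaluated along
    deleted, shifted or inverted increments. *)
Definition IO (x : A) (K : set A) : set (nat -> G) :=
  [set z : nat -> G | forall n, exists m, (n <= m)%N /\ K (x + \sum_(i < m) phi (z i))].

Lemma mseq_IO x K : mseq (IO x K).
Proof.
rewrite (_ : IO x K = \bigcap_n \bigcup_m
    [set z : nat -> G | (n <= m)%N /\ K (x + \sum_(i < m) phi (z i))]); last first.
  apply/seteqP; split=> z zK n; first by move=> _; have [m] := zK n; exists m.
  by have [m _] := zK n I; exists m.
apply: mseq_bigcap => n; apply: mseq_bigcup => m.
apply: (mseq_finitary eS (n := m)) => z z' zz' [nm Kz]; split=> //.
rewrite (eq_bigr (fun i : 'I_m => phi (z i))) // => i _.
by rewrite zz'.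
Qed.

Definition hit (x : A) (K : set A) : R := pr P (traj zeta @^-1` IO x K).

(** By commutativity of [A], the increment at [N] can be moved into the starting point for all times
    past [N]; the time shift by one does not affect infinite recurrence. *)
Lemma IO_delete N g x K w : zeta N w = g ->
  IO x K (traj zeta w) <->
  IO (x + phi g) K (traj (fun i => zeta (bump N i)) w).
Proof.
move=> wg.
have E m : (N <= m)%N -> x + \sum_(i < m.+1) phi (traj zeta w i) =
    x + phi g + \sum_(i < m) phi (traj (fun i => zeta (bump N i)) w i).
  move=> Nm; have Nm' : (N < m.+1)%N by rewrite ltnS.
  by rewrite (bigD1_ord (Ordinal Nm')) //= -addrA /traj wg.
split=> io n.
  have [[|m] [nm Km]] := io (maxn n N).+1 => //.
  move: nm; rewrite ltnS geq_max => /andP[nm Nm].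
  by exists m; rewrite -E.
have [m [nm Km]] := io (maxn n N).
move: nm; rewrite geq_max => /andP[nm Nm].
by exists m.+1; rewrite E // leqW.
Qed.

Lemma IO_shift k (s : nat -> G) x K w : cyl k s (traj zeta w) ->
  IO x K (traj zeta w) <->
  IO (x + \sum_(i < k) phi (s i)) K (traj (fun i => zeta (k + i)%N) w).
Proof.
move=> ws.
have E m : x + \sum_(i < k + m) phi (traj zeta w i) =
    x + \sum_(i < k) phi (s i) + \sum_(i < m) phi (traj (fun i => zeta (k + i)%N) w i).
  rewrite big_split_ord /= addrA; congr (_ + _ + _).
  by apply: eq_bigr => i _; rewrite ws.
split=> io n.
  have [m [nm Km]] := io (k + n)%N; exists (m - k)%N.
  rewrite -E subnKC; last by apply: leq_trans nm; exact: leq_addr.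
  by split=> //; rewrite leq_subRL //; apply: leq_trans nm; exact: leq_addr.
have [m [nm Km]] := io n; exists (k + m)%N.
by rewrite E; split=> //; apply: leq_trans nm _; exact: leq_addl.
Qed.

(** By deletion, the joint probability with [zeta N = g] is [mu g * hit (x + phi g) K] for every
    [N]; by mixing it tends to [mu g * hit x K]. *)
Lemma hit_letter g x K : 0 < mu g -> hit (x + phi g) K = hit x K.
Proof.
move=> g0; have c1 := @pr_mixing g _ (mseq_IO x K).
have E N : pr P (traj zeta @^-1` IO x K `&` [set w | zeta N w = g]) =
    mu g * hit (x + phi g) K.
  rewrite setIC -(@pr_delete N); last exact: mseq_IO.
  congr (pr P _); apply/seteqP; split=> w /= [wg]; split=> //.
    exact/(IO_delete _ _ wg).
  exact/(IO_delete _ _ wg).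
move: c1; under eq_fun do rewrite E.
move=> c1; apply: (mulfI (lt0r_neq0 g0)).
have c0 : mu g * hit (x + phi g) K @[_ --> \oo] --> mu g * hit (x + phi g) K.
  exact: cvg_cst.
exact: (cvg_unique _ c0 c1).
Qed.

Lemma hit_const x K : hit x K = hit 0 K.
Proof.
have [y <-] := phi_surj x.
suff H a : hit (a + phi y) K = hit a K by rewrite -(H 0) add0r.
elim: (mu_gen y) a => {x y} [g g0||y y' _ Hy _ Hy'|y _ Hy] a.
- exact: hit_letter.
- by rewrite phi1 addr0.
- by rewrite phiM addrA Hy' Hy.
- by rewrite phiV -(Hy (a - phi y)) subrK.
Qed.

(* [IO] is independent of every cylinder, hence of itself. *)
Lemma hit_01 K : hit 0 K = 0 \/ hit 0 K = 1.
Proof.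
have sK := mseq_IO 0 K.
have H n f : (0 <= n)%N ->
    pr P (traj zeta @^-1` IO 0 K `&` traj zeta @^-1` cyl n f) =
    hit 0 K * pr P (traj zeta @^-1` cyl n f).
  (* Given the first [n] increments the walk restarts from another point, which by [hit_const]
     leaves the probability unchanged. *)
  move=> _; rewrite mulrC -(hit_const (0 + \sum_(i < n) phi (f i)) K) setIC.
  rewrite -pr_shift; last exact: mseq_IO.
  congr (pr P _); apply/seteqP; split=> w /= [wf]; split=> //.
    exact/(IO_shift _ _ wf).
  exact/(IO_shift _ _ wf).
have := pr_unique eS (mpre sK) mzeta mzeta H sK.
rewrite setIid -/(hit 0 K) => /eqP.
rewrite -subr_eq0 -{1}(mulr1 (hit 0 K)) -mulrBr mulf_eq0 subr_eq0.
by move=> /orP[/eqP|/eqP <-]; [left|right].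
Qed.

(** By symmetry of [mu] the inverted increments have the same law, and [phi] turns them into the
    negated walk. *)
Lemma hit_opp K : hit 0 (-%R @^-1` K) = hit 0 K.
Proof.
pose z' i w := ((zeta i w)^-1)%g.
have mz' i g : measurable [set w | z' i w = g].
  rewrite (_ : [set w | _] = [set w | zeta i w = g^-1%g]) //.
  by apply/seteqP; split=> w /=; rewrite /z'; [move=> <-|move=> ->]; rewrite invgK.
have H n f : (0 <= n)%N -> pr P (setT `&` traj z' @^-1` cyl n f) =
    1 * pr P (traj zeta @^-1` cyl n f).
  move=> _; rewrite setTI mul1r pr_cyl.
  rewrite (_ : _ @^-1` _ = traj zeta @^-1` cyl n (fun i => (f i)^-1%g)).
    by rewrite pr_cyl; apply: eq_bigr => i _; rewrite mu_sym.
  apply/seteqP; split=> w /= wf i i_n.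
    by rewrite -wf // /traj /z' invgK.
  by rewrite /traj /z' -[zeta i w]/(traj zeta w i) wf // invgK.
have := pr_unique eS measurableT mzeta mz' H (mseq_IO 0 K).
rewrite setTI mul1r -/(hit 0 K) => <-; congr (pr P _).
apply/seteqP; split=> w /= io n; have [m [nm Km]] := io n; exists m; split=> //;
  move: Km; rewrite /= !add0r -sumrN;
  by congr K; apply: eq_bigr => i _; rewrite /traj /z' phiV ?opprK.
Qed.

End RandomWalk.

(** * Recurrence *)

Section FinitelyGenerated.
Variables (G : groupType) (s : seq G).
Hypothesis sG : forall x, subgroup_gen [set y | y \in s] x.

Lemma fg_enumeration : exists e : nat -> G, forall g, exists n, e n = g.
Proof.
(* A letter is a position in [s] with an inversion flag; positions past the end give the neutral
   element. *)
pose letter (a : bool * nat) : G :=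
  (if a.1 then (nth 1 s a.2)^-1 else nth 1 s a.2)%g.
pose word (u : seq (bool * nat)) : G := (\prod_(a <- u) letter a)%g.
exists (fun n => word (odflt [::] (unpickle n))) => g.
suff [u <-] : exists u, word u = g by exists (pickle u); rewrite pickleK.
elim: (sG g) => {g} [g gs||_ _ _ [u <-] _ [v <-]|_ _ [u <-]].
- by exists [:: (false, index g s)]; rewrite /word big_seq1 /letter /= nth_index.
- by exists [::]; rewrite /word big_nil.
- by exists (u ++ v); rewrite /word big_cat.
- exists [seq (~~ a.1, a.2) | a <- rev u]; rewrite /word big_map.
  elim: u => [|a u IH]; first by rewrite !big_nil invg1.
  rewrite rev_cons -cats1 big_cat big_seq1 /= IH big_cons invgM; congr (_ * _)%g.
  by rewrite /letter /=; case: a.1 => //=; rewrite invgK.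
Qed.

Lemma fg_image_span (A : zmodType) (phi : G -> A) :
  (forall x y, phi (x * y)%g = phi x + phi y) ->
  (forall a, exists x, phi x = a) ->
  forall a, exists c : 'I_(size s) -> int,
    a = \sum_(j < size s) phi (nth 1%g s j) *~ c j.
Proof.
move=> phiM phi_surj a; have [x <-] := phi_surj a.
elim: (sG x) => {x} [x xs||x y _ [c cE] _ [c' cE']|x _ [c cE]].
- have xlt : (index x s < size s)%N by rewrite index_mem.
  exists (fun j => (j == Ordinal xlt)%:Z).
  rewrite (bigD1 (Ordinal xlt)) //= eqxx mulr1z nth_index // big1 ?addr0 // => j.
  by move=> /negPf ->; rewrite mulr0z.
- by exists (fun=> 0); rewrite (phi1 phiM) big1 // => j _; rewrite mulr0z.
- exists (fun j => c j + c' j); rewrite phiM cE cE'.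
  by under [RHS]eq_bigr do rewrite mulrzDr; rewrite big_split.
- exists (fun j => - c j); rewrite (phiV phiM) cE -sumrN.
  by apply: eq_bigr => j _; rewrite mulrNz.
Qed.

End FinitelyGenerated.

Lemma negligible_bigcup_countType (R : realType) (d : measure_display)
    (T : measurableType d) (P : probability T R) (I : countType) (F : I -> set T) :
  (forall i, P.-negligible (F i)) -> P.-negligible (\bigcup_i F i).
Proof.
move=> F0; pose F' k := if unpickle k is Some i then F i else set0.
apply: (@negligibleS _ _ _ P (\bigcup_k F' k)).
  by move=> w [i _ Fw]; exists (pickle i) => //; rewrite /F' pickleK.
apply: negligible_bigcup => k; rewrite /F'; case: (unpickle k) => // .
exact: negligible_set0.
Qed.

(** * The walk on the abelianization *)

Section Abelianization.
Variables (G : groupType) (e : nat -> G).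
Hypothesis eS : forall g, exists n, e n = g.
Context {R : realType} {d : measure_display} {T : measurableType d}.
Variables (P : probability T R) (mu : G -> R) (zeta : nat -> T -> G).
Hypothesis mu_ge0 : forall g, 0 <= mu g.
Hypothesis mu_sym : symmetric_measure mu.
Hypothesis mu_gen : forall x, subgroup_gen [set g | 0 < mu g] x.
Hypothesis zeta_iid : iid_with_law P mu zeta.
Variables (A : zmodType) (phi : G -> A).
Hypothesis phiM : forall x y, phi (x * y)%g = phi x + phi y.
Hypothesis phi_surj : forall a, exists x, phi x = a.
Variables (k : nat) (g : 'I_k -> A).
Hypothesis gA : forall x, exists c : 'I_k -> int, x = \sum_j g j *~ c j.

Let mIO x K : measurable (traj zeta @^-1` IO phi x K).
Proof. by apply: traj_measurable; [case: zeta_iid|exact: (mseq_IO eS)]. Qed.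

(** Past the last visit to [K], every visit to the union is a visit to [K']. *)
Lemma hit_setU0 K K' : hit P zeta phi 0 K = 0 -> hit P zeta phi 0 K' = 0 ->
  hit P zeta phi 0 (K `|` K') = 0.
Proof.
move=> K0 K'0.
have : P.-negligible (traj zeta @^-1` IO phi 0 K `|` traj zeta @^-1` IO phi 0 K').
  by apply: negligibleU; apply/pr_negligible.
move=> N0; apply/pr_negligible => //; apply: negligibleS N0.
move=> w io; have [ioK|nioK] := pselect (IO phi 0 K (traj zeta w)); [by left|right].
have /existsNP[n0 nK] := nioK.
move=> n; have [m [nm [Km|Km]]] := io (maxn n n0).
  by case: nK; exists m; split=> //; apply: leq_trans nm; exact: leq_maxr.
by exists m; split=> //; apply: leq_trans nm; exact: leq_maxl.
Qed.

Lemma hit_le K K' : K `<=` K' -> hit P zeta phi 0 K <= hit P zeta phi 0 K'.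
Proof.
move=> KK'; apply: pr_le => // w io n; have [m [nm Km]] := io n.
by exists m; split=> //; exact: KK'.
Qed.

(** Sets whose complement is almost surely visited finitely often form a proper filter; [p] is an
    ultrafilter refining it. If [K] in [p] had probability 0, its complement would be in [p] too, so
    the zero-one law gives 1. *)
Lemma recurrent_ultrafilter : exists2 p : set_system A, UltraFilter p &
  forall K, p K -> hit P zeta phi 0 K = 1.
Proof.
pose F : set_system A := [set K | hit P zeta phi 0 (~` K) = 0].
have FF : ProperFilter F.
  split.
    rewrite /F /= setC0 /hit (_ : _ @^-1` _ = setT) ?prT.
      by move/eqP; rewrite oner_eq0.
    by apply/seteqP; split=> // w _ n; exists n.
  split=> [|K K' FK FK'|K K' KK' FK].
  - rewrite /F /= setCT /hit (_ : _ @^-1` _ = set0) ?pr0 //.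
    by rewrite -subset0 => w /(_ 0%N)[m []].
  - by rewrite /F /= setCI; exact: hit_setU0.
  - apply/eqP; rewrite eq_le pr_ge0 andbT -FK; apply: hit_le.
    exact: subsetC.
have [p [pU Fp]] := ultraFilterLemma FF.
exists p => // K pK.
have [K0|//] := hit_01 eS mu_ge0 mu_gen zeta_iid phiM phi_surj K.
have /(filterI pK) : p (~` K) by apply: Fp; rewrite /F /= setCK.
by rewrite setICr => /filter_not_empty.
Qed.

Lemma sgoK b : involutive (@sgo A b).
Proof. by case: b => x //=; rewrite /sgo opprK. Qed.

Lemma hit_sgo K b x : hit P zeta phi 0 K = 1 ->
  hit P zeta phi x (sgo b @^-1` K) = 1.
Proof.
move=> K1; rewrite (hit_const eS mu_ge0 mu_gen zeta_iid phiM phi_surj).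
case: b => //.
by rewrite -[RHS]K1; exact: (hit_opp eS mu_sym zeta_iid phiM).
Qed.

Lemma walk_onto_abelianization n : P.-negligible
  [set w | ~ forall x, exists2 y, rw_semigroup zeta n w y & phi y = phi x].
Proof.
have [p pU pK] := recurrent_ultrafilter.
have [s ps] := sign_relation_pall gA pU.
pose K pre l := [set x : A | pall p l (fun t => sign_relation s (pre ++ x :: t))].
pose dec (u : seq nat) : seq A := map (phi \o e) u.
(* Prefixes and shifts are coded by naturals through [e], so that the exceptional events form a
   countable family. *)
pose N1 (i : (seq nat * nat) * (bool * nat)) : set T :=
  [set w | p (K (dec i.1.1) i.1.2) /\
    ~ IO phi (- phi (e i.2.2)) (sgo i.2.1 @^-1` K (dec i.1.1) i.1.2) (traj zeta w)].
pose N2 (j : nat) : set T :=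
  [set w | 0 < mu (e j) /\ forall m, (n <= m)%N -> zeta m w <> e j].
have N10 i : P.-negligible (N1 i).
  have [pKi|npKi] := pselect (p (K (dec i.1.1) i.1.2)); last first.
    by apply: (negligibleS _ (negligible_set0 P)) => w [].
  apply: (@negligibleS _ _ _ P (~` (traj zeta @^-1` IO phi (- phi (e i.2.2))
    (sgo i.2.1 @^-1` K (dec i.1.1) i.1.2)))) => [w []//|].
  apply/pr_negligible; first exact: measurableC.
  rewrite prC // -[pr P _]/(hit P zeta phi _ _).
  by rewrite hit_sgo ?subrr //; exact: pK.
have N20 j : P.-negligible (N2 j).
  have [ej|nej] := pselect (0 < mu (e j)); last first.
    by apply: (negligibleS _ (negligible_set0 P)) => w [].
  apply: (@negligibleS _ _ _ P [set w | forall m, (n <= m)%N -> zeta m w <> e j]).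
    by move=> w [].
  have mN : measurable [set w | forall m, (n <= m)%N -> zeta m w <> e j].
    rewrite (_ : [set w | _] = \bigcap_(m in [set m | (n <= m)%N]) ~` [set w | zeta m w = e j]).
      apply: bigcap_measurableType => m _; apply: measurableC.
      by case: zeta_iid.
    by apply/seteqP; split.
  apply/pr_negligible => //.
  by rewrite (letter_infinitely_often eS mu_ge0 zeta_iid).
apply: (negligibleS _ (negligibleU (negligible_bigcup_countType N10)
                                   (negligible_bigcup_countType N20))) => w /= bad.
apply: contrapT => /not_orP[nN1 nN2]; apply: bad.
pose S := [set a : A | exists2 y, rw_semigroup zeta n w y & phi y = a].
have SD a b : S a -> S b -> S (a + b).
  by move=> [y Sy <-] [y' Sy' <-]; exists (y * y')%g; [exact: semi_mul|exact: phiM].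
have SX m : (n <= m)%N -> S (\sum_(i < m) phi (traj zeta w i)).
  move=> nm; exists (rw_pos zeta m w); last exact: (phi_prod phiM (traj zeta w)).
  by apply: semi_in; exists m.
have [idx idxE] := choice eS; have [lift liftE] := choice phi_surj.
have Smul c : exists m, S (c *+ m.+1).
  apply: (sign_relation_multiple SD ps) => pre l b pKl.
  have decE : dec (map (idx \o lift) pre) = pre.
    by rewrite /dec -map_comp map_id_in // => x _ /=; rewrite idxE liftE.
  have cE : phi (e (idx (lift c))) = c by rewrite idxE liftE.
  have io : IO phi (- c) (sgo b @^-1` K pre l) (traj zeta w).
    apply: contrapT => nio; apply: nN1.
    exists ((map (idx \o lift) pre, l), (b, idx (lift c))) => //.
    by rewrite /N1 /= decE cE.
  have [m [nm Km]] := io n.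
  exists (sgo b (- c + \sum_(i < m) phi (traj zeta w i))) => //.
  by rewrite sgoK addrC addNKr; exact: SX.
(* Adding [m] copies of [a] to [(m + 1) (- a)] leaves [- a]. *)
have SN a : S a -> S (- a).
  move=> Sa; have [m] := Smul (- a); elim: m => [|m IH]; first by rewrite mulr1n.
  by move=> Sm; apply: IH; have := SD _ _ Sm Sa; rewrite mulrS addrAC addNr add0r.
(* The letter [x] occurs at some time [m >= n], and [phi x] is then the difference of two
   consecutive positions, both in [S]. *)
have Sg x : 0 < mu x -> S (phi x).
  move=> x0; have [m nm xE] : exists2 m, (n <= m)%N & zeta m w = x.
    apply: contrapT => nx; apply: nN2; exists (idx x) => //.
    by rewrite /N2 /= idxE; split=> // m nm xE; apply: nx; exists m.
  have := SD _ _ (SX m.+1 (leqW nm)) (SN _ (SX m nm)).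
  by rewrite big_ord_recr /= addrAC subrr add0r /traj xE.
move=> x; change (S (phi x)).
elim: (mu_gen x) => {x} [x x0||x y _ Sx _ Sy|x _ Sx].
- exact: Sg.
- by rewrite (phi1 phiM) -(subrr (\sum_(i < n) phi (traj zeta w i)));
    apply: SD; [|apply: SN]; exact: SX.
- by rewrite phiM; exact: SD.
- by rewrite (phiV phiM); exact: SN.
Qed.

End Abelianization.

Theorem mainTheorem8 (G : groupType) :
  finitely_generated G -> nilpotent G -> alg_recurrent G.
Proof.
move=> fgG nilG R mu [mu_ge0 _] mu_sym mu_gen d T P zeta zeta_iid n.
have [s sG] := fgG; have [e eS] := fg_enumeration sG.
(* Indexing starts at [lower_central 0 = G], so term 1 is the commutator subgroup and [A] is the
   abelianization. *)
have NC x y : lcn G 1 [~ x, y]%g by exact: (@lcn_comm _ 0).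
have phiM := @abprojM _ _ NC; have phi_surj := @abproj_surj _ _ NC.
apply: negligibleS (walk_onto_abelianization eS mu_ge0 mu_sym mu_gen zeta_iid
  phiM phi_surj (fg_image_span sG phiM phi_surj) n) => w /= bad onto.
apply: bad; apply: semigroup_onto_abelianization => //.
  by move=> x y; exact: semi_mul.
move=> x; have [y Sy yx] := onto x; exists y => //.
exact: (abproj_inj yx).
Qed.
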